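(* Let $1<p<\infty$ and let $\Gamma$ be a countable group such that: 1. there is a subgroup $H$ of $\Gamma$ which is wq-normal with respect to the sequence $\{H_\alpha\}_{\alpha\le\beta}$; 2. there is a subgroup $K$ of $H$ which is finitely generated and has growth at least polynomial of degree $d>p$; 3. the inclusion $H_\alpha<H_{\alpha+1}$ is q-normal when $H_\alpha$ is finitely generated and normal otherwise; 4. either $\overline{H}^1(H,\lambda_{\ell^pH})=\{0\}$ or $Z^{FC}_{H_1}(H)$ is infinite. Then $\overline{H}^1(\Gamma,\lambda_{\ell^p\Gamma})=\{0\}$.
   Context: A subgroup $L<G$ is q-normal in $G$ if there is a generating set $A$ of $G$ such that $gLg^{-1}\cap L$ is infinite for all $g\in A$. A subgroup $H<\Gamma$ is wq-normal with respect to an increasing chain of subgroups $\{H_\alpha\}_{\alpha\le\beta}$ indexed by ordinals if $H_0=H$, $H_\beta=\Gamma$ and $\bigcup_{\alpha<\gamma}H_\alpha$ is q-normal in $H_\gamma$ for all $0<\gamma\le\beta$. The FC-centraliser of a subgroup $H$ of $G$ is $Z^{FC}_G(H)=\{g\in G:\{h^{-1}gh:h\in H\}\text{ is finite}\}$. $\lambda_{\ell^pG}$ is the left-regular representation of $G$ on $\ell^pG$. A cocycle is a map $b:G\to\ell^pG$ with $b(gh)=b(g)+\lambda_{\ell^pG}(g)b(h)$; coboundaries are the cocycles $g\mapsto\lambda_{\ell^pG}(g)\xi-\xi$ with $\xi\in\ell^pG$; $\overline{H}^1(G,\lambda_{\ell^pG})$ is the quotient of the space of cocycles by the closure (for pointwise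 convergence on $G$) of the space of coboundaries. Growth at least polynomial of degree $d$ means balls of radius $n$ for a word metric of a finite generating set have at least $cn^d$ elements for some $c>0$ and all $n\ge1$. *)

(* Defs.v *)
From HB Require Import structures.
From mathcomp Require Import all_boot all_order all_algebra.
From mathcomp Require Import finmap.
From mathcomp Require Import all_classical all_reals all_analysis.
From mathcomp Require Import complex.
From mathcomp Require Import wochoice.

Set Implicit Arguments.
Unset Strict Implicit.
Unset Printing Implicit Defensive.

Import Order.TTheory GRing.Theory Num.Theory.

Local Open Scope classical_set_scope.
Local Open Scope ring_scope.

(* A subgroup of G is a [groupClosed G]; as a group in its own right, on which
   functions and cocycles can be defined, it is the following subtype of G. *)
Section SubgroupAsGroup.
Variables (G : groupType) (H : groupClosed G).

Definition subgroup_type : Type := {x : G | x \in H}.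

HB.instance Definition _ := SubChoice.on subgroup_type.

Fact subgroup_type_closed : group_closed (fun x : G => x \in H).
Proof. by split; [exact: gpred1 | exact: gpredF]. Qed.

HB.instance Definition _ :=
  SubChoice_isSubGroup.Build G (fun x : G => x \in H) subgroup_type
    subgroup_type_closed.
End SubgroupAsGroup.

Section Subgroups.
Variable G : groupType.
Implicit Types (A L M S : set G) (g : G).

Definition is_subgroup M : Prop := group_closed (mem M).

Definition generated A : set G := smallest is_subgroup A.

Definition conj_set g L : set G := [set (g * x * g^-1)%g | x in L].

Definition q_normal L M : Prop :=
  L `<=` M /\
  exists A : set G, generated A = M /\
    forall g, A g -> infinite_set (conj_set g L `&` L).

Definition normal_in L M : Prop :=
  L `<=` M /\ forall g, M g -> conj_set g L = L.

Definition finitely_generated M : Prop :=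
  exists S : set G, finite_set S /\ generated S = M.

(* Z^FC_M(L) *)
Definition FC_centraliser M L : set G :=
  [set g | M g /\ finite_set [set (h^-1 * g * h)%g | h in L]].

(* The ball of radius n about 1 for the word metric of S. *)
Definition word_ball S (n : nat) : set G :=
  [set (\prod_(s <- w) s)%g
    | w in [set w : seq G | (size w <= n)%N /\
                            forall s, s \in w -> S s \/ S (s^-1)%g]].

Definition growth_at_least (R : realType) (d : R) M : Prop :=
  exists S : set G, [/\ finite_set S, generated S = M &
    exists2 c : R, 0 < c & forall n : nat, (0 < n)%N ->
      c * n%:R `^ d <= (#|` fset_set (word_ball S n)|)%:R].

(* The ordinals alpha <= beta are represented by a well-ordered type I with a
   bottom (the ordinal 0) and a top (the ordinal beta): up to isomorphism these
   are exactly the well-ordered sets [0, beta]. *)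
Definition wq_normal (L : set G) disp (I : tbOrderType disp) (Hs : I -> set G)
    : Prop :=
  [/\ well_order (<=%O : rel I),
      forall a b : I, (a <= b)%O -> Hs a `<=` Hs b,
      Hs \bot%O = L,
      Hs \top%O = [set: G] &
      forall c : I, (\bot < c)%O ->
        q_normal (\bigcup_(a in [set a | (a < c)%O]) Hs a) (Hs c)].

End Subgroups.

(* b = a + 1 *)
Definition ord_succ disp (I : porderType disp) (a b : I) : Prop :=
  (a < b)%O /\ forall c : I, (a < c)%O -> (b <= c)%O.

Section ReducedCohomology.
Variables (R : realType) (p : R) (G : groupType).
Implicit Types (f xi : G -> R[i]) (b : G -> G -> R[i]).

Definition lp_norm f : \bar R :=
  ((\esum_(x in [set: G]) (ComplexField.Normc.normc (f x) `^ p)%:E) `^ p^-1)%E.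

(* Elements of l^p G *)
Definition lp : set (G -> R[i]) := [set f | (lp_norm f < +oo)%E].

Definition left_regular (g : G) f : G -> R[i] := fun x => f (g^-1 * x)%g.

Definition cocycles : set (G -> G -> R[i]) :=
  [set b | (forall g, lp (b g)) /\
    forall g h, b (g * h)%g = b g \+ left_regular g (b h)].

Definition coboundaries : set (G -> G -> R[i]) :=
  [set (fun g => left_regular g xi \- xi) | xi in lp].

(* Closure for pointwise convergence on G of functions G -> l^p G: the basic
   neighbourhoods of b are given by a finite subset of G and a radius. *)
Definition pointwise_closure (B : set (G -> G -> R[i]))
    : set (G -> G -> R[i]) :=
  [set b | forall F : set G, finite_set F -> forall e : R, 0 < e ->
     exists2 b', B b' & forall g, F g -> (lp_norm (b g \- b' g)%R < e%:E)%E].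

(* The quotient of cocycles by the closure of coboundaries is {0} exactly when
   the former is included in the latter. *)
Definition reduced_H1_trivial : Prop :=
  cocycles `<=` pointwise_closure coboundaries.

End ReducedCohomology.

Arguments growth_at_least {G R} d M.
Arguments reduced_H1_trivial {R} p G.

(* Main.v *)
(* Put [f x = b(x^-1)(1)], so that [b g = g f - f]; the class of [b] vanishes as
   soon as [f] is a constant plus a function [xi] vanishing at infinity, because
   truncating [xi] then gives finitely supported approximations.
   Growth of degree [d > p] yields the Sobolev inequality [|xi| <= C |dif xi|_p]
   on l^p, so if the restriction of [b] to [H] is a limit of coboundaries
   [h xi_n - xi_n], then the [xi_n] converge uniformly to a function [xi]
   vanishing at infinity and [w = f - xi] is [H]-invariant.  For every [g] the
   function [g w - w] vanishes at infinity.  If [w] is [L]-invariant and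
   [g L g^-1 `&` L] is infinite, then [g w - w] is invariant under that infinite
   set, hence zero; so the invariance of [w] propagates along the q-normal
   inclusions, and [w] is constant.
   That the restriction of [b] to [H] is a limit of coboundaries follows from
   the first alternative one right coset of [H] at a time (all but finitely many
   cosets carry little mass), and from the second by averaging [b] over large
   finite sets invariant under conjugation by [H]. *)
Require Import Defs.
From mathcomp Require Import all_boot all_order all_algebra.
From mathcomp Require Import all_classical all_reals all_analysis.
From mathcomp Require Import complex finmap lra ring.

Set Implicit Arguments.
Unset Strict Implicit.
Unset Printing Implicit Defensive.

Import Order.TTheory GRing.Theory Num.Theory.

Local Open Scope classical_set_scope.
Local Open Scope ring_scope.

(** * Bounds on p-th power sums, and functions vanishing at infinity *)

Section LpBounds.
Variables (R : realType) (p : R).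
Hypothesis p_gt1 : 1 < p.

Let p_gt0 : 0 < p. Proof. exact: lt_trans p_gt1. Qed.

Implicit Types (e : R).

Lemma ler_powRp (a b : R) : 0 <= a -> a <= b -> a `^ p <= b `^ p.
Proof.
move=> a0 ab; apply: ge0_ler_powR => //; first exact: ltW.
by rewrite nnegrE (le_trans a0).
Qed.

Lemma ler_powRp_inv (a b : R) : 0 <= b -> a `^ p <= b `^ p -> a <= b.
Proof.
move=> b0; rewrite leNgt => h; rewrite leNgt; apply: contra h => ba.
by apply: gt0_ltr_powR; rewrite // nnegrE // (le_trans b0)// ltW.
Qed.

(* Young's inequality [a m^(p-1) <= a^p / p + m^p / q], with [m] the mean. *)
Lemma powR_mean_le (I : eqType) (s : seq I) (a : I -> R) :
  s != [::] -> (forall i, 0 <= a i) ->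
  ((\sum_(i <- s) a i) / (size s)%:R) `^ p <=
  (\sum_(i <- s) a i `^ p) / (size s)%:R.
Proof.
move=> s0 a0; set n : R := (size s)%:R; set m := _ / n.
have n0 : 0 < n by rewrite ltr0n lt0n size_eq0.
have m0 : 0 <= m by rewrite divr_ge0 ?sumr_ge0// ltW.
pose q := p / (p - 1).
have p10 : 0 < p - 1 by rewrite subr_gt0.
have q0 : 0 < q by rewrite divr_gt0.
have pq : p^-1 + q^-1 = 1 by rewrite /q invf_div; field; rewrite !gt_eqF.
have mq : (m `^ (p - 1)) `^ q = m `^ p.
  by rewrite -powRrM /q mulrC divfK // gt_eqF.
have yg i : a i * m `^ (p - 1) <= a i `^ p / p + m `^ p / q.
  by rewrite -mq conjugate_powR// powR_ge0.
have : \sum_(i <- s) a i * m `^ (p - 1) <=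
       \sum_(i <- s) (a i `^ p / p + m `^ p / q).
  by apply: ler_sum => i _.
rewrite -mulr_suml big_split /= -mulr_suml.
rewrite big_const_seq count_predT iter_addr addr0.
have -> : \sum_(i <- s) a i = n * m by rewrite /m mulrC divfK// gt_eqF.
rewrite -mulrA mulr_powRB1// -[_ *+ size s]mulr_natl -/n.
have -> : q^-1 = 1 - p^-1 by rewrite -pq addrAC subrr add0r.
rewrite mulrBr mulr1 mulrBr addrCA lerDl subr_ge0 => h.
rewrite ler_pdivlMr// mulrC.
by move: h; rewrite mulrA ler_pM2r// invr_gt0.
Qed.

Section Bounds.
Variable T : choiceType.
Implicit Types (u v : T -> R) (M : R).

(** [M] bounds the p-th power of the norm (the energy). Quantifying over finite lists keeps
    summability out of the estimates. *)
Definition lp_le u M :=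
  forall s : seq T, uniq s -> \sum_(x <- s) `|u x| `^ p <= M.

Lemma lp_le_ge0 u M : lp_le u M -> 0 <= M.
Proof. by move=> /(_ [::] erefl); rewrite big_nil. Qed.

Lemma lp_le_pointwise u M x : lp_le u M -> `|u x| `^ p <= M.
Proof. by move=> /(_ [:: x] erefl); rewrite big_seq1. Qed.

Lemma lp_leW u M M' : M <= M' -> lp_le u M -> lp_le u M'.
Proof. by move=> MM' h s /h /le_trans; exact. Qed.

Lemma lp_le_dominated u v M :
  (forall x, `|u x| <= `|v x|) -> lp_le v M -> lp_le u M.
Proof.
move=> uv vM s /vM; apply: le_trans; apply: ler_sum => x _.
exact: ler_powRp.
Qed.

Lemma lp_leN u M : lp_le u M -> lp_le (\- u) M.
Proof. by apply: lp_le_dominated => x /=; rewrite normrN. Qed.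

(** Convexity of the p-th power at each point gives a bound that does not depend on the number of
    functions averaged. *)
Lemma lp_le_mean (I : eqType) (s : seq I) (u : I -> T -> R) M :
  s != [::] -> (forall i, i \in s -> lp_le (u i) M) ->
  lp_le (fun x => (\sum_(i <- s) u i x) / (size s)%:R) M.
Proof.
move=> s0 uM t t_uniq.
have n0 : 0 < (size s)%:R :> R by rewrite ltr0n lt0n size_eq0.
apply: (@le_trans _ _
  (\sum_(x <- t) (\sum_(i <- s) `|u i x| `^ p) / (size s)%:R)).
  apply: ler_sum => x _.
  have := @powR_mean_le _ s (fun i => `|u i x|) s0 (fun=> normr_ge0 _).
  apply: le_trans; apply: ler_powRp => //.
  rewrite normrM normfV normr_nat ler_pM2r ?invr_gt0//.
  exact: ler_norm_sum.
rewrite -mulr_suml exchange_big /= ler_pdivrMr// mulr_natr.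
rewrite -[leRHS]addr0 -iter_addr -(count_predT s) -big_const_seq.
by rewrite big_seq [leRHS]big_seq; apply: ler_sum => i /uM; exact.
Qed.

Lemma lp_leZ c u M : lp_le u M -> lp_le (fun x => c * u x) (`|c| `^ p * M).
Proof.
move=> uM s s_uniq; under eq_bigr do rewrite normrM powRM//.
by rewrite -mulr_sumr ler_wpM2l ?powR_ge0// uM.
Qed.

Lemma lp_le_sum (I : eqType) (s : seq I) (u : I -> T -> R) M :
  0 <= M -> (forall i, i \in s -> lp_le (u i) M) ->
  lp_le (fun x => \sum_(i <- s) u i x) ((size s)%:R `^ p * M).
Proof.
move=> M0 uM; have [->|s0] := eqVneq s [::].
  move=> t _; rewrite big1 ?mulr_ge0 ?powR_ge0// => x _.
  by rewrite big_nil normr0 powR0// gt_eqF.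
have := lp_leZ (size s)%:R (lp_le_mean s0 uM); rewrite normr_nat.
apply: lp_le_dominated => x.
by rewrite mulrC divfK // pnatr_eq0 size_eq0.
Qed.

Lemma lp_leD u v M : lp_le u M -> lp_le v M -> lp_le (u \+ v) (2 `^ p * M).
Proof.
move=> uM vM.
have := @lp_le_sum bool [:: true; false] (fun b => if b then u else v) M.
move=> /(_ (lp_le_ge0 uM)) h; apply: lp_le_dominated (h _) => [x|[]] //=.
by rewrite big_cons big_seq1.
Qed.

Lemma lp_leB u v M : lp_le u M -> lp_le v M -> lp_le (u \- v) (2 `^ p * M).
Proof. by move=> uM /lp_leN; exact: lp_leD. Qed.

Lemma lp_le_support u (s : seq T) t : 0 <= t ->
  (forall x, `|u x| <= t) -> (forall x, x \notin s -> u x = 0) ->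
  lp_le u ((size s)%:R * t `^ p).
Proof.
move=> t0 ut us r r_uniq.
rewrite (bigID (mem s)) /= [X in _ + X]big1 ?addr0; last first.
  by move=> x /us ->; rewrite normr0 powR0// gt_eqF.
rewrite -big_filter.
apply: (@le_trans _ _ (\sum_(x <- [seq x <- r | x \in s]) t `^ p)).
  by apply: ler_sum => x _; exact: ler_powRp.
rewrite big_const_seq count_predT iter_addr addr0 -[leLHS]mulr_natl.
rewrite ler_wpM2r ?powR_ge0// ler_nat; apply: uniq_leq_size.
  exact: filter_uniq.
by move=> x; rewrite mem_filter => /andP[].
Qed.

(** A finite sum within [e] of the supremum leaves less than [e] to any list disjoint from it. *)
Lemma lp_le_tail u M e : lp_le u M -> 0 < e ->
  exists s : seq T, forall v,
    (forall x, `|v x| <= `|u x|) -> (forall x, x \in s -> v x = 0) -> lp_le v e.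
Proof.
move=> uM e0.
pose A := [set \sum_(x <- s) `|u x| `^ p | s in [set s : seq T | uniq s]].
have hA : has_sup A.
  split; first by exists 0; exists [::] => //; rewrite big_nil.
  by exists M => _ [s s_uniq <-]; exact: uM.
have [_ [s /= s_uniq <-] sA] := sup_adherent e0 hA.
exists s => v vu vs t t_uniq.
have -> : \sum_(x <- t) `|v x| `^ p =
          \sum_(x <- [seq x <- t | x \notin s]) `|v x| `^ p.
  rewrite big_filter (bigID (mem s)) /= big1 ?add0r// => x /vs ->.
  by rewrite normr0 powR0// gt_eqF.
set t' := [seq _ <- _ | _].
have ub : \sum_(x <- s ++ t') `|u x| `^ p <= sup A.
  apply: ub_le_sup; first by case: hA.
  exists (s ++ t') => //=; rewrite cat_uniq s_uniq filter_uniq// andbT /=.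
  by apply/hasPn => x; rewrite mem_filter => /andP[].
have : \sum_(x <- t') `|v x| `^ p <= \sum_(x <- t') `|u x| `^ p.
  by apply: ler_sum => x _; exact: ler_powRp.
move: ub sA; rewrite big_cat /=; lra.
Qed.

Definition vanishing u := forall e, 0 < e -> finite_set [set x | e <= `|u x|].

(** Chebyshev: [n] points where [u] has absolute value at least [e] carry energy at least [n e^p],
    which exceeds [M] for large [n]. *)
Lemma lp_le_vanishing u M : lp_le u M -> vanishing u.
Proof.
move=> uM e e0; apply: contrapT => inf.
have [n nM] : exists n : nat, M < n%:R * e `^ p.
  have := archi_boundP (divr_ge0 (lp_le_ge0 uM) (powR_ge0 e p)).
  by rewrite ltr_pdivrMr ?powR_gt0// => Mn; eexists; exact: Mn.
have [B BA nB] := infinite_set_fset n inf.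
suff : M < M by rewrite ltxx.
apply: lt_le_trans (uM (enum_fset B) (fset_uniq B)).
apply: lt_le_trans nM _.
apply: (@le_trans _ _ (\sum_(x <- enum_fset B) e `^ p)).
  rewrite big_const_seq count_predT iter_addr addr0 -[leRHS]mulr_natl.
  by rewrite ler_wpM2r ?powR_ge0// ler_nat.
rewrite big_seq [leRHS]big_seq; apply: ler_sum => x xB.
by apply: ler_powRp; [exact: ltW | exact: BA].
Qed.

Lemma vanishingD u v : vanishing u -> vanishing v -> vanishing (u \+ v).
Proof.
move=> u0 v0 e e0; have e20 : 0 < e / 2 by rewrite divr_gt0.
apply: (sub_finite_set _ (_ : finite_set
   ([set x | e / 2 <= `|u x|] `|` [set x | e / 2 <= `|v x|]))).
  move=> x /= ex; have := ler_normD (u x) (v x).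
  case: (leP (e / 2) `|u x|) => ?; first by left.
  by case: (leP (e / 2) `|v x|) => ? ?; [right | exfalso; lra].
by rewrite finite_setU; split; [exact: u0 | exact: v0].
Qed.

Lemma vanishingN u : vanishing u -> vanishing (\- u).
Proof. by move=> h e /h; apply: sub_finite_set => x /=; rewrite normrN. Qed.

End Bounds.

Lemma lp_le_comp (T T' : choiceType) (f : T -> T') (u : T' -> R) M :
  injective f -> lp_le u M -> lp_le (u \o f) M.
Proof.
move=> f_inj uM s s_uniq /=.
by rewrite -(big_map f predT (fun y => `|u y| `^ p)) uM// map_inj_uniq.
Qed.

Lemma vanishing_comp (T T' : choiceType) (f : T -> T') (u : T' -> R) :
  injective f -> vanishing u -> vanishing (u \o f).
Proof.
move=> f_inj u0 e /u0; apply: finite_preimage; exact: in2W.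
Qed.

End LpBounds.

(** * Translations, differences and averages over finite sets *)

Definition translate (G : groupType) (V : Type) (g : G) (f : G -> V) : G -> V :=
  fun x => f (g^-1 * x)%g.

Lemma translateM (G : groupType) (V : Type) (g h : G) (f : G -> V) :
  translate (g * h)%g f = translate g (translate h f).
Proof. by apply/funext => x; rewrite /translate invgM mulgA. Qed.

Section Translation.
Variables (R : realType) (p : R) (G : groupType).
Hypothesis p_gt1 : 1 < p.
Implicit Types (xi u : G -> R) (g : G).

Let p_gt0 : 0 < p. Proof. exact: lt_trans p_gt1. Qed.

Definition dif g xi : G -> R := translate g xi \- xi.

Lemma lp_le_translate g u M : lp_le p u M -> lp_le p (translate g u) M.
Proof. by apply: lp_le_comp; exact: mulgI. Qed.

(** Telescoping: [g h xi - xi] is [g xi - xi] plus the translate by [g] of [h xi - xi], so each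
    letter contributes one translated difference. An inverse letter is covered by
    [s xi - xi = - s (s^-1 xi - xi)]. *)
Lemma lp_le_dif_word (S : set G) xi (t : R) (w : seq G) : 0 <= t ->
  (forall s, S s -> lp_le p (dif s xi) (t `^ p)) ->
  (forall s, s \in w -> S s \/ S s^-1%g) ->
  lp_le p (dif (\prod_(s <- w) s)%g xi) (((size w)%:R * t) `^ p).
Proof.
move=> t0 St wS.
suff [us [us_size us_le us_sum]] : exists us : seq (G -> R),
    [/\ size us = size w, forall u, u \in us -> lp_le p u (t `^ p) &
        forall x, dif (\prod_(s <- w) s)%g xi x = \sum_(u <- us) u x].
  rewrite powRM// -us_size.
  have := @lp_le_sum _ _ p_gt1 _ _ us id _ (powR_ge0 t p) us_le.
  by apply: lp_le_dominated => // x; rewrite us_sum.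
elim: w wS => [_|s w IHw wS].
  exists [::]; split => // x.
  by rewrite !big_nil /dif /translate /= invg1 mul1g subrr.
have [|us [us_size us_le us_sum]] := IHw.
  by move=> r rw; apply: wS; rewrite inE rw orbT.
exists (dif s xi :: [seq translate s u | u <- us]); split.
- by rewrite /= size_map us_size.
- move=> u; rewrite inE => /predU1P[->|/mapP[v vus ->]].
    have [//|sS|sS] := wS s; first by rewrite inE eqxx.
      exact: St.
    have := lp_leN p_gt1 (lp_le_translate s (St _ sS)).
    apply: lp_le_dominated => // x.
    by rewrite /dif /translate /= invgK mulVKg opprB.
  by apply: lp_le_translate; exact: us_le.
- move=> x; rewrite !big_cons big_map.
  have -> : \sum_(u <- us) translate s u x =
            dif (\prod_(r <- w) r)%g xi (s^-1 * x)%g by rewrite us_sum.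
  by rewrite /dif translateM /translate /=; ring.
Qed.

Definition average (B : seq G) xi : G -> R :=
  fun x => (\sum_(y <- B) translate y xi x) / (size B)%:R.

Lemma averageB B xi u x :
  average B (xi \- u) x = average B xi x - average B u x.
Proof. by rewrite /average -mulrBl -sumrB. Qed.

Lemma average_le B u (M : R) x : (forall x, `|u x| <= M) -> 0 <= M ->
  `|average B u x| <= M.
Proof.
move=> uM M0; rewrite /average normrM normfV normr_nat.
have [->|B0] := eqVneq B [::]; first by rewrite big_nil normr0 mul0r.
rewrite ler_pdivrMr ?ltr0n ?lt0n ?size_eq0//.
apply: le_trans (ler_norm_sum _ _ _) _.
apply: (@le_trans _ _ (\sum_(y <- B) M)).
  by apply: ler_sum => y _; exact: uM.
by rewrite big_const_seq count_predT iter_addr addr0 mulr_natr.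
Qed.

(** For fixed [x] the points [y^-1 * x] are distinct as [y] runs through [B], so the p-th powers add
    up to at most [M]; convexity does the rest. *)
Lemma average_pointwise B u M x : uniq B -> B != [::] -> lp_le p u M ->
  `|average B u x| `^ p <= M / (size B)%:R.
Proof.
move=> B_uniq B0 uM.
have := powR_mean_le p_gt1 B0 (fun y => normr_ge0 (translate y u x)).
have Bp : 0 < (size B)%:R :> R by rewrite ltr0n lt0n size_eq0.
move=> h; apply: (@le_trans _ _
  ((\sum_(y <- B) `|translate y u x| `^ p) / (size B)%:R)).
  apply: le_trans h; apply: ler_powRp => //.
  rewrite normrM normfV normr_nat ler_pM2r ?invr_gt0//.
  exact: ler_norm_sum.
rewrite ler_pM2r ?invr_gt0//.
rewrite -(big_map (fun y => y^-1 * x)%g predT (fun z => `|u z| `^ p)).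
by apply: uM; rewrite map_inj_uniq// => y z /mulIg /invg_inj.
Qed.

Lemma lp_le_average_sub B xi M : B != [::] ->
  (forall y, y \in B -> lp_le p (dif y xi) M) ->
  lp_le p (xi \- average B xi) M.
Proof.
move=> B0 BM; apply: lp_le_dominated (lp_le_mean p_gt1 B0 BM) => // x.
suff -> : (\sum_(y <- B) dif y xi x) / (size B)%:R = average B xi x - xi x.
  by rewrite distrC.
rewrite sumrB mulrBl big_const_seq count_predT iter_addr addr0.
by rewrite -[xi x *+ _]mulr_natr mulfK// pnatr_eq0 size_eq0.
Qed.

End Translation.

(** * Sobolev inequality from volume growth *)

Section Sobolev.
Variables (R : realType) (p : R) (G : groupType).
Hypothesis p_gt1 : 1 < p.
Variables (S : set G) (c d : R).
Hypotheses (c_gt0 : 0 < c) (p_ltd : p < d).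
Hypothesis growth : forall n, (0 < n)%N ->
  c * n%:R `^ d <= (#|` fset_set (word_ball S n)|)%:R.
Implicit Types (xi u : G -> R).

Let p_gt0 : 0 < p. Proof. exact: lt_trans p_gt1. Qed.

Let ball k : seq G := enum_fset (fset_set (word_ball S (2 ^ k))).

Let ball_word k y : y \in ball k -> word_ball S (2 ^ k) y.
Proof.
(* [fset_set] of an infinite set is empty, so the second case is vacuous. *)
move=> yB; have [fin|inf] := pselect (finite_set (word_ball S (2 ^ k))).
  by move: yB; rewrite in_fset_set// => /set_mem.
by move: yB; rewrite /ball /fset_set; case: pselect.
Qed.

(** Factor by which the lower bound on the p-th root of the volume grows when the radius doubles; it
    exceeds 2 because [p < d]. *)
Let theta := 2 `^ (d / p).

Let theta_gt2 : 2 < theta.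
Proof.
have dp : 0 < d / p - 1 by rewrite subr_gt0 ltr_pdivlMr// mul1r.
have {1}-> : 2 = 2 `^ 1 :> R by rewrite powRr1.
rewrite /theta -(subrK 1 (d / p)) powRD; last by apply/implyP.
rewrite powRr1// -[ltLHS]mul1r ltr_pM2r// lt_neqAle eq_sym powR_eq1.
rewrite pnatr_eq1 (gt_eqF dp) ltrn0 /=.
by rewrite -[leLHS](powRr0 2) ler_powR ?ler1n ?ltW.
Qed.

Let ball_size k : c * (theta ^+ k) `^ p <= (size (ball k))%:R.
Proof.
have := @growth (2 ^ k)%N; rewrite expn_gt0 => /(_ isT).
suff -> : (2 ^ k)%:R `^ d = (theta ^+ k) `^ p :> R by [].
rewrite natrX -!powR_mulrn ?powR_ge0// /theta -!powRrM; congr (2 `^ _).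
by field; rewrite gt_eqF.
Qed.

Let ball_neq0 k : ball k != [::].
Proof.
rewrite -size_eq0 -lt0n -(ltr_nat R); apply: lt_le_trans (ball_size k).
by rewrite mulr_gt0 ?powR_gt0 ?exprn_gt0// (lt_trans _ theta_gt2).
Qed.

Let c' := c `^ p^-1.

Let average_bound k u N x : 0 <= N -> lp_le p u (N `^ p) ->
  `|average (ball k) u x| <= N / (c' * theta ^+ k).
Proof.
move=> N0 uN.
have theta0 : 0 < theta by rewrite (lt_trans _ theta_gt2).
have c'0 : 0 < c' by rewrite powR_gt0.
have ct0 : 0 < c' * theta ^+ k by rewrite mulr_gt0 ?exprn_gt0.
apply: (ler_powRp_inv p_gt1); first by rewrite divr_ge0// ltW.
apply: le_trans (average_pointwise p_gt1 x (fset_uniq _) (ball_neq0 k) uN) _.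
have -> : (N / (c' * theta ^+ k)) `^ p = N `^ p / (c' * theta ^+ k) `^ p.
  rewrite (@powRM _ N) ?invr_ge0 ?(ltW ct0)//; congr (_ * _).
  by rewrite -powRN -[- p]mulN1r powRrM powR_inv1 ?ltW.
rewrite ler_wpM2l ?powR_ge0// lef_pV2 ?posrE ?powR_gt0//.
  apply: le_trans (ball_size k).
  rewrite powRM ?exprn_ge0 ?(ltW c'0) ?(ltW theta0)// /c' -powRrM.
  by rewrite mulVf ?gt_eqF// powRr1// ltW.
by rewrite ltr0n lt0n size_eq0 ball_neq0.
Qed.

(* With [A_k] the average over the ball of radius [2^k], bound [A_k xi] by
   [A_k (xi - A_(k+1) xi)] plus [A_k (A_(k+1) xi)]: the sup norm of the first term
   is at most a constant times [2^k (2^k)^(-d/p) t], which is summable as [d > p],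
   and that of the second is at most that of [A_(k+1) xi]. *)
Lemma lp_sup_le : exists2 C : R, 0 < C &
  forall xi t M, 0 <= t -> lp_le p xi M ->
    (forall s, S s -> lp_le p (dif s xi) (t `^ p)) ->
    forall x, `|xi x| <= C * t.
Proof.
have theta0 : 0 < theta by rewrite (lt_trans _ theta_gt2).
have c'0 : 0 < c' by rewrite powR_gt0.
pose q := 2 / theta.
have q0 : 0 < q by rewrite divr_gt0.
have q1 : 0 < 1 - q by rewrite subr_gt0 ltr_pdivrMr// mul1r.
exists (1 + (2 / c') / (1 - q)).
  by rewrite addr_gt0// !divr_gt0.
move=> xi t M t0 xiM St x.
have M0 := lp_le_ge0 xiM.
have sub_le k : lp_le p (xi \- average (ball k) xi) ((2 ^+ k * t) `^ p).
  apply: (lp_le_average_sub p_gt1 (ball_neq0 k)) => y /ball_word[w [wk wS] <-].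
  apply: lp_leW (lp_le_dif_word p_gt1 t0 St wS).
  apply: ler_powRp => //; first by rewrite mulr_ge0.
  by rewrite ler_wpM2r// -natrX ler_nat.
pose N := M `^ p^-1; pose a := 2 * t / c'.
have a0 : 0 <= a by rewrite divr_ge0 ?mulr_ge0// ltW.
have xiN : lp_le p xi (N `^ p).
  by rewrite /N -powRrM mulVf ?gt_eqF// powRr1.
(* Induction on the number [j] of scales. Since [q^k + q^(k+1) / (1 - q) = q^k / (1 - q)], the first
   summand absorbs every step; the second is the crude bound at scale [k + j]. *)
have step j : forall k y, `|average (ball k) xi y| <=
    a * q ^+ k / (1 - q) + N / (c' * theta ^+ (k + j)).
  elim: j => [|j IHj] k y.
    rewrite addn0; apply: le_trans (average_bound k y (powR_ge0 _ _) xiN) _.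
    by rewrite lerDr divr_ge0 ?(ltW q1)// mulr_ge0// exprn_ge0// ltW.
  have -> : average (ball k) xi y =
      average (ball k) (xi \- average (ball k.+1) xi) y +
      average (ball k) (average (ball k.+1) xi) y by rewrite averageB subrK.
  apply: le_trans (ler_normD _ _) _.
  have h1 : `|average (ball k) (xi \- average (ball k.+1) xi) y| <= a * q ^+ k.
    apply: le_trans (average_bound k y _ (sub_le k.+1)) _.
      by rewrite mulr_ge0// exprn_ge0.
    rewrite /a /q expr_div_n exprS.
    rewrite le_eqVlt; apply/orP; left; apply/eqP.
    by field; rewrite ?expf_neq0 ?gt_eqF.
  have h2 : `|average (ball k) (average (ball k.+1) xi) y| <=
      a * q ^+ k.+1 / (1 - q) + N / (c' * theta ^+ (k + j.+1)).
    apply: average_le => [z|].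
      by rewrite -addSnnS; exact: IHj.
    by rewrite addr_ge0 ?mulr_ge0 ?invr_ge0 ?mulr_ge0 ?exprn_ge0 ?powR_ge0
      ?(ltW q1) ?(ltW q0) ?(ltW c'0) ?(ltW theta0).
  apply: le_trans (lerD h1 h2) _.
  rewrite addrA lerD2r le_eqVlt; apply/orP; left; apply/eqP.
  by rewrite exprS; field; rewrite gt_eqF.
(* As [theta^j >= 2^j > j], the crude term falls below any [e], and with it goes the dependence on
   [M]. *)
have limit : `|average (ball 0) xi x| <= a / (1 - q).
  apply/ler_addgt0Pr => e e0.
  have [j jN] : exists j : nat, N / c' / e < j%:R.
    have : 0 <= N / c' / e by rewrite !divr_ge0 ?powR_ge0 ?(ltW c'0) ?(ltW e0).
    by move=> /archi_boundP h; eexists; exact: h.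
  apply: le_trans (step j 0%N x) _; rewrite expr0 mulr1 add0n lerD2l.
  rewrite invfM mulrA ler_pdivrMr ?exprn_gt0//.
  rewrite ltr_pdivrMr// in jN; apply: le_trans (ltW jN) _.
  rewrite mulrC ler_pM2l//; apply: (@le_trans _ _ (2 ^+ j)).
    by rewrite -natrX ler_nat ltnW// ltn_expl.
  by rewrite lerXn2r ?nnegrE ?ltW.
have first_step : `|xi x - average (ball 0) xi x| <= t.
  apply: (ler_powRp_inv p_gt1 t0).
  by have := lp_le_pointwise x (sub_le 0%N); rewrite expr0 mul1r.
have := ler_normD (xi x - average (ball 0) xi x) (average (ball 0) xi x).
rewrite subrK => /le_trans; apply.
rewrite mulrDl mul1r; apply: lerD => //.
apply: le_trans limit _; rewrite /a le_eqVlt; apply/orP; left; apply/eqP.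
by ring.
Qed.

End Sobolev.

(** * Uniform limits of approximate solutions, and propagation of invariance *)

Section Approximation.
Variables (R : realType) (p : R) (G : groupType).
Hypothesis p_gt1 : 1 < p.
Implicit Types (xi u : G -> R) (H : set G) (b : G -> G -> R).

(** Membership of the restriction of [b] to [H] in the closure of the coboundaries, the values still
    being functions on all of [G]; [e] bounds the p-th power of a norm. *)
Definition approx_coboundary H b :=
  forall s : seq G, (forall g, g \in s -> H g) -> forall e : R, 0 < e ->
  exists xi, (exists M, lp_le p xi M) /\
    forall g, g \in s -> lp_le p (b g \- dif g xi) e.

Lemma vanishing_dif g xi : vanishing xi -> vanishing (dif g xi).
Proof.
move=> xi0; apply: vanishingD; last exact: vanishingN.
by apply: (vanishing_comp (f := fun x => g^-1 * x)%g) xi0; exact: mulgI.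
Qed.

(* Any approximate solution [zeta] with error [t] on [s0] is within [D (t + t')]
   of any other, so the supremum of the lower bounds [zeta - D t] is their
   common uniform limit. *)
Lemma approx_coboundary_limit H b (s0 : seq G) (C : R) : 0 < C ->
  (forall s, s \in s0 -> H s) ->
  (forall xi t M, 0 <= t -> lp_le p xi M ->
    (forall s, s \in s0 -> lp_le p (dif s xi) (t `^ p)) ->
    forall x, `|xi x| <= C * t) ->
  approx_coboundary H b ->
  exists2 xi, vanishing xi & forall h, H h -> b h = dif h xi.
Proof.
move=> C0 s0H sup_le bH; pose D := C * 2.
have D0 : 0 < D by rewrite mulr_gt0.
pose P t zeta := (exists M, lp_le p zeta M) /\
  forall s, s \in s0 -> lp_le p (b s \- dif s zeta) (t `^ p).
have P_dist t zeta t' zeta' : 0 < t -> 0 < t' -> P t zeta -> P t' zeta' ->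
    forall x, `|zeta x - zeta' x| <= D * (t + t').
  move=> t0 t'0 [[M zM] zs] [[M' zM'] zs'] x.
  have tt0 : 0 <= t + t' by rewrite addr_ge0 ?ltW.
  rewrite /D -mulrA.
  (* The difference along [s] of [zeta - zeta'] is a difference of two error terms, each of energy
     at most [(t + t')^p]; hence the factor 2. *)
  apply: (sup_le (zeta \- zeta') (2 * (t + t')) (2 `^ p * (M + M'))).
  - by rewrite mulr_ge0.
  - apply: (lp_leB p_gt1); [apply: lp_leW zM|apply: lp_leW zM'].
      by rewrite lerDl (lp_le_ge0 zM').
    by rewrite lerDr (lp_le_ge0 zM).
  - move=> s ss0; rewrite powRM//.
    have h : lp_le p (b s \- dif s zeta') ((t + t') `^ p).
      apply: lp_leW (zs' s ss0); apply: ler_powRp => //; first exact: ltW.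
      by rewrite lerDr ltW.
    have h' : lp_le p (b s \- dif s zeta) ((t + t') `^ p).
      apply: lp_leW (zs s ss0); apply: ler_powRp => //; first exact: ltW.
      by rewrite lerDl ltW.
    apply: lp_le_dominated (lp_leB p_gt1 h h') => // y.
    suff -> : dif s (zeta \- zeta') y =
      ((b s \- dif s zeta') \- (b s \- dif s zeta)) y by [].
    by rewrite /dif /translate /=; ring.
pose A x := [set v | exists t zeta, [/\ 0 < t, P t zeta & v = zeta x - D * t]].
pose xi x := sup (A x).
(* Adjoining [h] to [s0] gives approximations that are accurate at [h] and, being accurate on [s0],
   still uniformly close to [xi]. *)
have exP t : 0 < t -> forall h, H h -> exists2 zeta, P t zeta &
    lp_le p (b h \- dif h zeta) (t `^ p).
  move=> t0 h Hh; have [|zeta [zM zs]] := bH (h :: s0) _ _ (powR_gt0 p t0).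
    by move=> g; rewrite inE => /predU1P[->//|/s0H].
  exists zeta; last by apply: zs; rewrite inE eqxx.
  by split => // s ss0; apply: zs; rewrite inE ss0 orbT.
have exP' t : 0 < t -> exists zeta, P t zeta.
  move=> t0; have [//|zeta zP] := bH s0 _ _ (powR_gt0 p t0).
  by exists zeta.
have xi_dist t zeta x : 0 < t -> P t zeta -> `|xi x - zeta x| <= D * t.
  move=> t0 zP.
  have zub : ubound (A x) (zeta x + D * t).
    move=> _ [t' [zeta' [t'0 zP' ->]]].
    have := P_dist _ _ _ _ t0 t'0 zP zP' x; rewrite ler_norml; lra.
  have zA : A x (zeta x - D * t) by exists t, zeta.
  have h1 : xi x <= zeta x + D * t.
    by apply: ge_sup zub; exists (zeta x - D * t).
  have h2 : zeta x - D * t <= xi x.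
    by apply: ub_le_sup zA; exists (zeta x + D * t).
  by rewrite ler_norml; lra.
exists xi.
  move=> e e0; pose t := e / 2 / D.
  have t0 : 0 < t by rewrite !divr_gt0.
  have [zeta zP] := exP' t t0.
  have [[M zM] _] := zP.
  apply: sub_finite_set (lp_le_vanishing p_gt1 zM (divr_gt0 e0 (ltr0n _ 2))).
  move=> x /= ex; have := xi_dist t zeta x t0 zP.
  rewrite /t mulrC divfK ?gt_eqF//.
  have := ler_normD (xi x - zeta x) (zeta x); rewrite subrK; lra.
move=> h Hh; apply/funext => x; apply/eqP; rewrite -subr_eq0 -normr_le0.
apply/ler_addgt0Pr => e e0; rewrite add0r.
(* One [t] pays for the error at [h], and one [D * t] for replacing [zeta] by [xi] at each of [x]
   and [h^-1 * x]. *)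
have D20 : 0 < 1 + 2 * D by rewrite addr_gt0 ?mulr_gt0.
pose t := e / (1 + 2 * D).
have t0 : 0 < t by rewrite divr_gt0.
have [zeta zP zh] := exP t t0 h Hh.
have -> : e = (1 + 2 * D) * t by rewrite /t mulrC divfK ?gt_eqF.
have h1 : `|b h x - dif h zeta x| <= t.
  by apply: (ler_powRp_inv p_gt1 (ltW t0)); exact: lp_le_pointwise x zh.
have := xi_dist t zeta x t0 zP; have := xi_dist t zeta (h^-1 * x)%g t0 zP.
move: h1; rewrite /dif /translate /= !ler_norml; lra.
Qed.

(** Were [u x] non-zero, the infinitely many points [h * x] would all lie in the finite set where
    [u] has absolute value at least that of [u x]. *)
Lemma vanishing_invariant_eq0 u (L : set G) : vanishing u -> infinite_set L ->
  (forall h x, L h -> u (h * x)%g = u x) -> forall x, u x = 0.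
Proof.
move=> u0 Linf uL x; apply/eqP; apply: contrapT => /negP ux0; apply: Linf.
have := u0 `|u x|; rewrite normr_gt0 => /(_ ux0) fin.
have : finite_set ((fun h => h * x)%g @^-1` [set y | `|u x| <= `|u y|]).
  by apply: finite_preimage fin; apply: in2W; exact: mulIg.
by apply: sub_finite_set => h Lh /=; rewrite uL.
Qed.

Definition invariance_group (w : G -> R) : set G := [set g | translate g w = w].

Lemma invariance_group_subgroup w : is_subgroup (invariance_group w).
Proof.
split; first by apply/mem_set/funext => x; rewrite /translate invg1 mul1g.
move=> g h /set_mem gw /set_mem hw; apply/mem_set.
rewrite /invariance_group /= translateM -[in RHS]gw; congr translate.
by rewrite -[in LHS]hw -translateM mulVg; apply/funext => x;
  rewrite /translate invg1 mul1g.
Qed.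

Lemma invariance_group_eq w h x : invariance_group w h -> w (h * x)%g = w x.
Proof. by move=> hw; rewrite -[in LHS]hw /translate mulKg. Qed.

(* A vanishing function invariant under an infinite set is zero, which is
   applied to [dif a w] and [a L a^-1 `&` L]. *)
Lemma q_normal_invariance w (L M : set G) :
  (forall g, vanishing (dif g w)) -> q_normal L M ->
  L `<=` invariance_group w -> M `<=` invariance_group w.
Proof.
move=> w0 [_ [A [<- Ainf]]] Lw; apply: smallest_sub.
  exact: invariance_group_subgroup.
move=> a /Ainf ainf; apply/funext => x; apply/eqP; rewrite -subr_eq0; apply/eqP.
apply: (vanishing_invariant_eq0 (w0 a) ainf) => _ {}x [[k Lk <-] Lh].
rewrite /dif /= (invariance_group_eq _ (Lw _ Lh)); congr (_ - _).
by rewrite /translate -!mulgA mulKg invariance_group_eq//; exact: Lw.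
Qed.

(** Transfinite induction, on a least index [z] where invariance fails: all earlier terms lie in the
    invariance group, hence so does their union, which is q-normal in [Hs z]. *)
Lemma wq_normal_invariance w H disp (I : tbOrderType disp) (Hs : I -> set G) :
  (forall g, vanishing (dif g w)) -> wq_normal H Hs ->
  H `<=` invariance_group w -> forall g, translate g w = w.
Proof.
move=> w0 [wo Hs_mono Hs_bot Hs_top Hs_q] Hw.
suff Hs_w c : Hs c `<=` invariance_group w.
  by move=> g; apply: (Hs_w \top%O); rewrite Hs_top.
apply: contrapT => c_bad.
pose bad : {pred I} := [pred c | `[< ~ (Hs c `<=` invariance_group w) >]].
have [|z [[/asboolP z_bad z_min] _]] := wo bad.
  by exists c; apply/asboolP.
apply: z_bad; have [->|z0] := eqVneq z \bot%O; first by rewrite Hs_bot.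
apply: (q_normal_invariance w0 (Hs_q z _)); first by rewrite lt0x.
move=> g [a /= az Ha]; apply: contrapT => gw.
have : a \in bad by apply/asboolP => /(_ _ Ha).
by move=> /z_min; rewrite leNgt az.
Qed.

End Approximation.

(** * Truncation, and averages over large finite sets *)

Definition clamp (R : realType) (t x : R) : R := Num.max (- t) (Num.min t x).

Lemma clamp_le (R : realType) (t x : R) : 0 <= t -> `|clamp t x| <= t.
Proof.
move=> t0; rewrite /clamp /Num.max /Num.min ler_norml.
by case: ifP; case: ifP => *; lra.
Qed.

Lemma clamp_id (R : realType) (t x : R) : `|x| <= t -> clamp t x = x.
Proof.
rewrite /clamp /Num.max /Num.min ler_norml => /andP[? ?].
by case: (ltP t x) => ?; case: ltP => ?; lra.
Qed.

Lemma clamp_lip (R : realType) (t x y : R) : 0 <= t ->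
  `|clamp t x - clamp t y| <= `|x - y|.
Proof.
move=> t0; rewrite /clamp /Num.max /Num.min.
have := ler_norm (x - y); have := ler_norm (y - x); rewrite (distrC y x) => ? ?.
rewrite ler_norml.
by case: (ltP t x) => ?; case: (ltP t y) => ?; case: ltP => ?; case: ltP => ?;
  lra.
Qed.

Section Truncation.
Variables (R : realType) (p : R) (G : groupType).
Hypothesis p_gt1 : 1 < p.
Implicit Types (xi u : G -> R) (b : G -> G -> R).

Let p_gt0 : 0 < p. Proof. exact: lt_trans p_gt1. Qed.

(** A form of dominated convergence: outside a finite set [s] the energy of [u] is small, and on [s]
    that of [v] is at most [t^p] per point. *)
Lemma lp_le_min (T : choiceType) (u : T -> R) M e : lp_le p u M -> 0 < e ->
  exists2 t0, 0 < t0 & forall t v, 0 < t -> t <= t0 ->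
    (forall x, `|v x| <= `|u x|) -> (forall x, `|v x| <= t) -> lp_le p v e.
Proof.
move=> uM e0; pose e' := e / 2 `^ p.
have e'0 : 0 < e' by rewrite divr_gt0 ?powR_gt0.
have [s sP] := lp_le_tail p_gt1 uM e'0.
have n0 : 0 < (size s).+1%:R :> R by rewrite ltr0n.
exists ((e' / (size s).+1%:R) `^ p^-1); first by rewrite powR_gt0 ?divr_gt0.
move=> t v t0 tt vu vt.
have -> : e = 2 `^ p * e' by rewrite mulrC divfK ?gt_eqF ?powR_gt0.
pose v1 x := if x \in s then v x else 0.
pose v2 x := if x \in s then 0 else v x.
suff h : lp_le p (v1 \+ v2) (2 `^ p * e').
  apply: lp_le_dominated h => // x /=; rewrite /v1 /v2.
  by case: ifP; rewrite ?addr0 ?add0r.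
apply: (lp_leD p_gt1).
  apply: (@lp_leW _ _ _ _ ((size s)%:R * t `^ p)); last first.
    apply: (lp_le_support p_gt1 (ltW t0)) => x.
      by rewrite /v1; case: ifP; rewrite ?normr0 ?(ltW t0).
    by rewrite /v1 => /negbTE ->.
  have := ler_powRp p_gt1 (ltW t0) tt.
  rewrite -powRrM mulVf ?gt_eqF// powRr1 ?(ltW (divr_gt0 e'0 n0))//.
  rewrite ler_pdivlMr// => h; apply: le_trans h.
  by rewrite mulrC ler_wpM2l ?powR_ge0// ler_nat.
apply: sP => x; rewrite /v2; first by case: ifP; rewrite ?normr0.
by move=> ->.
Qed.

(** The finitely supported [xi - clamp t xi] approximates with error [dif g (clamp t xi)]. This is
    dominated by [b g], clamping being 1-Lipschitz, and by [2 t], so its energy tends to 0 with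
    [t]. *)
Lemma approx_coboundary_vanishing b xi : vanishing xi ->
  (forall g, b g = dif g xi) -> (forall g, exists M, lp_le p (b g) M) ->
  approx_coboundary p setT b.
Proof.
move=> xi0 bE bM s _ e e0.
suff [t0 t00 tP] : exists2 t0, 0 < t0 & forall t, 0 < t -> t <= t0 ->
    forall g, g \in s -> lp_le p (dif g (clamp t \o xi)) e.
  exists (xi \- (clamp t0 \o xi)); split.
    have /finite_seqP[r rE] := xi0 t0 t00.
    have vr x : x \notin r -> (xi \- (clamp t0 \o xi)) x = 0.
      move=> xr; rewrite /= clamp_id ?subrr// leNgt; apply: contra xr => tx.
      have : [set x | t0 <= `|xi x|] x by rewrite /= ltW.
      by rewrite rE.
    pose m := \sum_(x <- r) `|(xi \- (clamp t0 \o xi)) x|.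
    exists ((size r)%:R * m `^ p); apply: lp_le_support => //.
      by rewrite sumr_ge0.
    move=> x; have [xr|/vr ->] := boolP (x \in r); last first.
      by rewrite normr0 sumr_ge0.
    by rewrite /m (big_rem x xr) /= lerDl sumr_ge0.
  move=> g gs; apply: lp_le_dominated (tP t0 t00 (lexx _) g gs) => // x.
  suff -> : (b g \- dif g (xi \- (clamp t0 \o xi))) x =
    dif g (clamp t0 \o xi) x by [].
  by rewrite bE /dif /translate /=; ring.
elim: s => [|g s [t1 t10 t1P]]; first by exists 1.
have [M gM] := bM g; have [t2 t20 t2P] := lp_le_min gM e0.
(* Halved because a difference of two clamped values can reach [2 t]. *)
exists (Num.min t1 (t2 / 2)); first by rewrite lt_min t10 divr_gt0.
move=> t t0; rewrite le_min => /andP[tt1 tt2] h.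
rewrite inE => /predU1P[->|]; last exact: t1P.
apply: (t2P (t * 2)); rewrite ?mulr_gt0//.
- by rewrite -ler_pdivlMr.
- by move=> x; rewrite bE /dif /translate /=; apply: clamp_lip; exact: ltW.
- move=> x; rewrite /dif /translate /=; apply: le_trans (ler_normB _ _) _.
  by rewrite mulr_natr mulr2n lerD// clamp_le// ltW.
Qed.

(** Split [u] into [u1] supported on a finite [s] and [u2] of small energy, which averaging does not
    increase. At most [|s|] translates of [u1] are non-zero at a given point, so the average of [u1]
    has energy at most [|s|^p M |W|^(1-p)], which tends to 0 as [p > 1]. *)
Lemma lp_le_average_small u M e : lp_le p u M -> 0 < e ->
  exists N, forall W : seq G, uniq W -> (N < size W)%N ->
    lp_le p (average W u) e.
Proof.
move=> uM e0; pose e' := e / 2 `^ p.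
have e'0 : 0 < e' by rewrite divr_gt0 ?powR_gt0.
have eE : e = 2 `^ p * e' by rewrite mulrC divfK ?gt_eqF ?powR_gt0.
have [s sP] := lp_le_tail p_gt1 uM e'0.
pose u1 x := if x \in s then u x else 0.
pose u2 x := if x \in s then 0 else u x.
have u1M : lp_le p u1 M.
  by apply: lp_le_dominated uM => // x; rewrite /u1; case: ifP; rewrite ?normr0.
have u2e : lp_le p u2 e'.
  apply: sP => x; rewrite /u2; first by case: ifP; rewrite ?normr0.
  by move=> ->.
have p10 : 0 < p - 1 by rewrite subr_gt0.
pose X := (size s)%:R `^ p * M / e'.
have X0 : 0 <= X.
  by rewrite divr_ge0 ?mulr_ge0 ?powR_ge0 ?(lp_le_ge0 uM)// ltW.
have [N XN] : exists N : nat, X `^ (p - 1)^-1 < N%:R.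
  by have /archi_boundP h := powR_ge0 X (p - 1)^-1; eexists; exact: h.
exists N => W W_uniq NW.
have W0 : W != [::] by rewrite -size_eq0 -lt0n (leq_ltn_trans _ NW).
have k0 : 0 < (size W)%:R :> R by rewrite ltr0n lt0n size_eq0.
have XW : X <= (size W)%:R `^ (p - 1).
  have -> : X = (X `^ (p - 1)^-1) `^ (p - 1).
    by rewrite -powRrM mulVf ?gt_eqF// powRr1.
  apply: ge0_ler_powR; rewrite ?nnegrE ?powR_ge0 ?ltW//.
  by apply: lt_trans XN _; rewrite ltr_nat.
have h2 : lp_le p (average W u2) e'.
  by apply: (lp_le_mean p_gt1 W0) => z _; exact: lp_le_translate.
have sum1 : lp_le p (fun x => \sum_(z <- W) translate z u1 x)
    ((size s)%:R `^ p * ((size W)%:R * M)).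
  move=> t t_uniq; apply: (@le_trans _ _ (\sum_(x <- t)
      (size s)%:R `^ p * \sum_(z <- W) `|translate z u1 x| `^ p)); last first.
    rewrite -mulr_sumr ler_wpM2l ?powR_ge0// exchange_big /= mulr_natl.
    rewrite -[leRHS]addr0 -iter_addr -(count_predT W) -big_const_seq.
    by apply: ler_sum => z _; apply: (lp_le_translate z u1M).
  apply: ler_sum => x _; pose r := [seq z <- W | (z^-1 * x)%g \in s].
  have -> : \sum_(z <- W) translate z u1 x = \sum_(z <- r) translate z u1 x.
    rewrite big_filter [LHS](bigID (fun z => (z^-1 * x)%g \in s)) /=.
    rewrite [X in _ + X]big1 ?addr0// => z /negbTE zs.
    by rewrite /translate /u1 zs.
  have rs : (size r <= size s)%N.
    rewrite -(size_map (fun z => z^-1 * x)%g r); apply: uniq_leq_size.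
      by rewrite map_inj_uniq ?filter_uniq// => y z /mulIg /invg_inj.
    by move=> _ /mapP[z + ->]; rewrite mem_filter => /andP[].
  have [->|r0] := eqVneq r [::].
    by rewrite big_nil normr0 powR0 ?gt_eqF// mulr_ge0 ?powR_ge0// sumr_ge0// =>
      z _; rewrite powR_ge0.
  have n0 : 0 < (size r)%:R :> R by rewrite ltr0n lt0n size_eq0.
  have rle : \sum_(z <- r) `|translate z u1 x| `^ p <=
      \sum_(z <- W) `|translate z u1 x| `^ p.
    rewrite big_filter [leRHS](bigID (fun z => (z^-1 * x)%g \in s)) /=.
    by rewrite lerDl sumr_ge0// => z _; rewrite powR_ge0.
  apply: (@le_trans _ _ ((\sum_(z <- r) `|translate z u1 x|) `^ p)).
    by apply: ler_powRp => //; exact: ler_norm_sum.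
  have := powR_mean_le p_gt1 r0 (fun z => normr_ge0 (translate z u1 x)).
  move=> mean; have -> : \sum_(z <- r) `|translate z u1 x| =
      (size r)%:R * ((\sum_(z <- r) `|translate z u1 x|) / (size r)%:R).
    by rewrite mulrC divfK ?gt_eqF.
  rewrite powRM ?divr_ge0 ?sumr_ge0//.
  apply: ler_pM; rewrite ?powR_ge0//.
    by apply: ler_powRp; rewrite ?ler0n ?ler_nat.
  apply: le_trans mean _; apply: le_trans rle.
  rewrite ler_pdivrMr//; apply: ler_peMr; last by rewrite ler1n lt0n size_eq0.
  by apply: sumr_ge0 => z _; rewrite powR_ge0.
have h1 : lp_le p (average W u1) e'.
  apply: lp_leW (lp_le_dominated p_gt1 _ (lp_leZ (size W)%:R^-1 sum1)) => [|x].
    rewrite normfV normr_nat -powR_inv1 ?(ltW k0)// -powRrM mulN1r powRN.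
    rewrite -(mulr_powRB1 (ltW k0))//.
    move: XW; rewrite /X; set K := _ `^ (p - 1); set S := _ `^ p.
    have K0 : 0 < K by rewrite powR_gt0.
    rewrite ler_pdivrMr// => XW.
    have -> : ((size W)%:R * K)^-1 * (S * ((size W)%:R * M)) = S * M / K.
      by field; rewrite !gt_eqF.
    by rewrite ler_pdivrMr// (mulrC e').
  by rewrite /average mulrC.
rewrite eE; apply: lp_le_dominated (lp_leD p_gt1 h1 h2) => // x /=.
rewrite /average -mulrDl -big_split /=.
rewrite [in leRHS](eq_bigr (fun z => translate z u x)) // => z _.
by rewrite /translate /u1 /u2; case: ifP; rewrite ?addr0 ?add0r.
Qed.

End Truncation.

(** * Real cocycles: the FC-centraliser and right cosets *)

Section RealCocycles.
Variables (R : realType) (p : R) (G : groupType).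
Hypothesis p_gt1 : 1 < p.
Implicit Types (xi u : G -> R) (b : G -> G -> R).

Definition real_cocycle b := forall g h, b (g * h)%g = b g \+ translate g (b h).

(** Evaluate [b (x^-1 g) = b (x^-1) + x^-1 b g] at 1: the last term becomes [b g x]. *)
Lemma real_cocycle_dif b : real_cocycle b ->
  forall g, b g = dif g (fun x => b x^-1%g 1%g).
Proof.
move=> bc g; apply/funext => x.
rewrite /dif /translate /= invgM invgK bc /= /translate invgK mulg1.
by rewrite addrAC subrr add0r.
Qed.

(** Take the union of the finite [H]-conjugation orbits of more than [N] elements of the
    FC-centraliser. *)
Lemma conj_invariant_finite (Z : set G) (H : groupClosed G) N :
  infinite_set (FC_centraliser Z [set` H]) ->
  exists W : seq G, [/\ uniq W, (N < size W)%N &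
    forall h z, h \in H -> z \in W -> (h * z * h^-1)%g \in W].
Proof.
move=> /(infinite_set_fset N.+1)[B BZ NB].
pose orb z := [set (h^-1 * z * h)%g | h in [set` H]].
have Wfin : finite_set (\bigcup_(z in [set` B]) orb z).
  by apply: bigcup_finite => [|z /BZ[]//]; exact: finite_fset.
exists (enum_fset (fset_set (\bigcup_(z in [set` B]) orb z))); split.
- exact: fset_uniq.
- apply: leq_trans NB _; apply: uniq_leq_size; first exact: fset_uniq.
  move=> z zB; rewrite in_fset_set//; apply/mem_set; exists z => //.
  by exists 1%g; [exact: gpred1 | rewrite invg1 mul1g mulg1].
- move=> h z hH; rewrite !in_fset_set// => /set_mem[y yB [k kH <-]].
  apply/mem_set; exists y => //; exists (k * h^-1)%g.
    by rewrite /= gpredM// gpredV.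
  by rewrite invgM invgK !mulgA.
Qed.

(* If [W] is invariant under conjugation by [h], then summing
   [b (h z h^-1) + h z h^-1 b h = b (h z) = b h + h b z] over [z] in [W] shows
   that [b h] differs from the coboundary of minus the mean of [b] over [W] by
   [average W (b h)], which is small when [W] is large. *)
Lemma approx_coboundary_FC b (Z : set G) (H : groupClosed G) :
  real_cocycle b -> (forall g, exists M, lp_le p (b g) M) ->
  infinite_set (FC_centraliser Z [set` H]) -> approx_coboundary p [set` H] b.
Proof.
move=> bc bM Zinf s sH e e0.
have [N NP] : exists N, forall W : seq G, uniq W -> (N < size W)%N ->
    forall g, g \in s -> lp_le p (average W (b g)) e.
  elim: s {sH} => [|g s [N NP]]; first by exists 0%N.
  have [M gM] := bM g; have [N' N'P] := lp_le_average_small p_gt1 gM e0.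
  exists (maxn N N') => W W_uniq; rewrite gtn_max => /andP[NW N'W] h.
  by rewrite inE => /predU1P[->|]; [exact: N'P | exact: NP].
have [W [W_uniq NW WH]] := conj_invariant_finite N Zinf.
have W0 : W != [::] by case: W NW {W_uniq WH}.
pose mean x := (\sum_(z <- W) b z x) / (size W)%:R.
exists (\- mean); split.
  have [M ZM] : exists M, forall z, z \in W -> lp_le p (b z) M.
    elim: W {W_uniq NW WH W0 mean} => [|z W [M WM]]; first by exists 0.
    have [M' zM'] := bM z; exists (Num.max M M') => y.
    rewrite inE => /predU1P[->|/WM yM].
      by apply: lp_leW zM'; rewrite le_max lexx orbT.
    by apply: lp_leW yM; rewrite le_max lexx.
  by exists M; apply: (lp_leN p_gt1); exact: lp_le_mean.
move=> h hs; have hH : h \in H by exact: sH.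
apply: lp_le_dominated (NP W W_uniq NW h hs) => // x.
suff -> : (b h \- dif h (\- mean)) x = average W (b h) x by [].
have n0 : (size W)%:R != 0 :> R by rewrite pnatr_eq0 size_eq0.
pose c z := (h * z * h^-1)%g.
have c_inj : injective c by move=> y z /mulIg /mulgI.
have cW : perm_eq [seq c z | z <- W] W.
  have c_uniq : uniq [seq c z | z <- W] by rewrite map_inj_uniq.
  have sub : {subset [seq c z | z <- W] <= W}.
    by move=> _ /mapP[z zW ->]; exact: WH.
  apply: uniq_perm => //.
  by have [] := uniq_min_size c_uniq sub; rewrite ?size_map.
have sum_c (F : G -> R) : \sum_(z <- W) F (c z) = \sum_(z <- W) F z.
  by rewrite -(big_map c predT F); apply: perm_big.
have key z : b h x + b z (h^-1 * x)%g = b (c z) x + b h ((c z)^-1 * x)%g.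
  have : (h * z = c z * h)%g by rewrite /c mulgVK.
  by move=> /(congr1 b); rewrite !bc => /(congr1 (@^~ x)).
have : \sum_(z <- W) (b h x + b z (h^-1 * x)%g) =
       \sum_(z <- W) (b (c z) x + b h ((c z)^-1 * x)%g) by apply: eq_bigr.
rewrite !big_split /= (sum_c (b^~ x)) (sum_c (fun z => b h (z^-1 * x)%g)).
rewrite big_const_seq count_predT iter_addr addr0 -[b h x *+ _]mulr_natr => E.
apply: (mulIf n0); rewrite /average divfK//.
rewrite /dif /translate /mean /=.
transitivity (b h x * (size W)%:R + \sum_(z <- W) b z (h^-1 * x)%g
  - \sum_(z <- W) b z x); first by field.
by rewrite E addrAC subrr add0r.
Qed.

Lemma approx_coboundaryD (H : set G) b b' : approx_coboundary p H b ->
  approx_coboundary p H b' ->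
  approx_coboundary p H (fun g x => b g x + b' g x).
Proof.
move=> bH bH' s sH e e0.
have e'0 : 0 < e / 2 `^ p by rewrite divr_gt0 ?powR_gt0.
have [xi [[M xM] xs]] := bH s sH _ e'0.
have [xi' [[M' xM'] xs']] := bH' s sH _ e'0.
exists (xi \+ xi'); split.
  exists (2 `^ p * (M + M')); apply: (lp_leD p_gt1).
    by apply: lp_leW xM; rewrite lerDl (lp_le_ge0 xM').
  by apply: lp_leW xM'; rewrite lerDr (lp_le_ge0 xM).
move=> g gs; have -> : e = 2 `^ p * (e / 2 `^ p).
  by rewrite mulrC divfK ?gt_eqF ?powR_gt0.
apply: lp_le_dominated (lp_leD p_gt1 (xs g gs) (xs' g gs)) => // x.
set l := (X in `|X| <= _); set r := (X in _ <= `|X|).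
suff -> : l = r by [].
by rewrite /l /r /dif /translate /=; ring.
Qed.

Variable H : groupClosed G.

(** The functions are cut off outside the right cosets [H y], [y] in [r]. Left translation by [H]
    preserves these cosets, so the cut-off commutes with the action of [H]. *)
Definition coset_restriction (r : seq G) b : G -> G -> R := fun g x =>
  if has (fun y => (x * y^-1)%g \in H) r then b g x else 0.

(** Up to a small energy, the finitely many functions [b g] live on a finite set [r], hence on the
    cosets meeting it, and these are added one at a time. *)
Lemma approx_coboundary_cosets b :
  (forall g, exists M, lp_le p (b g) M) ->
  (forall y, approx_coboundary p [set` H] (coset_restriction [:: y] b)) ->
  approx_coboundary p [set` H] b.
Proof.
move=> bM b_coset.
have b_cosets r : approx_coboundary p [set` H] (coset_restriction r b).
  elim: r => [|y r IHr].
    move=> s _ e e0; exists (fun=> 0).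
    have lp0 M : 0 <= M -> lp_le p (fun _ : G => 0 : R) M.
      move=> M0 t _; rewrite big1// => x _.
      by rewrite normr0 powR0// gt_eqF// (lt_trans _ p_gt1).
    split; first by exists 0; exact: lp0.
    move=> g _; apply: lp_le_dominated (lp0 e (ltW e0)) => // x.
    by rewrite /dif /translate /= subrr subr0.
  (* Either the coset of [y] is already present and adds nothing, or it is disjoint from the others
     and the restrictions add up. *)
  have [yr|/hasPn yr] := boolP (has (fun z => (y * z^-1)%g \in H) r).
    suff -> : coset_restriction (y :: r) b = coset_restriction r b by [].
    apply/funext => g; apply/funext => x; rewrite /coset_restriction /=.
    case: (boolP ((x * y^-1)%g \in H)) => //= xy.
    suff -> : has (fun z => (x * z^-1)%g \in H) r by [].
    have /hasP[z zr yz] := yr; apply/hasP; exists z => //.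
    by rewrite -[x](mulgVK y) -mulgA gpredM.
  suff -> : coset_restriction (y :: r) b =
      (fun g x => coset_restriction [:: y] b g x + coset_restriction r b g x).
    exact: approx_coboundaryD.
  apply/funext => g; apply/funext => x; rewrite /coset_restriction /= orbF.
  case: (boolP ((x * y^-1)%g \in H)) => /= xy; last by rewrite add0r.
  rewrite ifF ?addr0//; apply/negbTE/hasPn => z /yr; apply: contra => xz.
  have -> : (y * z^-1 = (x * y^-1)^-1 * (x * z^-1))%g.
    by rewrite invgM invgK -mulgA mulKg.
  by rewrite gpredM// gpredV.
move=> s sH e e0; pose e' := e / 2 `^ p.
have e'0 : 0 < e' by rewrite divr_gt0 ?powR_gt0.
have [r rP] : exists r : seq G, forall g, g \in s -> forall v : G -> R,
    (forall x, `|v x| <= `|b g x|) -> (forall x, x \in r -> v x = 0) ->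
    lp_le p v e'.
  elim: s {sH} => [|g s [r rP]]; first by exists [::].
  have [M gM] := bM g; have [r' r'P] := lp_le_tail p_gt1 gM e'0.
  exists (r ++ r') => h; rewrite inE => /predU1P[->|hs] v vb v0.
    by apply: r'P => // x xr; apply: v0; rewrite mem_cat xr orbT.
  by apply: (rP h hs) => // x xr; apply: v0; rewrite mem_cat xr.
have [xi [xM xs]] := b_cosets r s sH e' e'0.
exists xi; split=> // g gs.
have -> : e = 2 `^ p * e' by rewrite mulrC divfK ?gt_eqF ?powR_gt0.
have off : lp_le p (b g \- coset_restriction r b g) e'.
  apply: (rP g gs) => x; rewrite /coset_restriction /=.
    by case: ifP; rewrite ?subrr ?subr0 ?normr0.
  move=> xr; rewrite ifT ?subrr//; apply/hasP; exists x => //.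
  by rewrite mulgV gpred1.
apply: lp_le_dominated (lp_leD p_gt1 off (xs g gs)) => // x.
by rewrite /= addrA subrK.
Qed.

End RealCocycles.

(** * Passage between complex l^p spaces and real energy bounds *)

Local Notation normc := ComplexField.Normc.normc.

Section ComplexNorm.
Variable R : realType.
Implicit Type z : R[i].

Lemma normc_ge0 z : 0 <= normc z.
Proof. by case: z => a b /=; exact: sqrtr_ge0. Qed.

Lemma Re_le_normc z : `|complex.Re z| <= normc z.
Proof.
case: z => a b /=; rewrite -sqrtr_sqr ler_wsqrtr//.
by rewrite lerDl sqr_ge0.
Qed.

Lemma Im_le_normc z : `|complex.Im z| <= normc z.
Proof.
case: z => a b /=; rewrite -sqrtr_sqr ler_wsqrtr//.
by rewrite lerDr sqr_ge0.
Qed.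

Lemma normc_le z : normc z <= `|complex.Re z| + `|complex.Im z|.
Proof.
case: z => a b /=; have ab0 : 0 <= `|a| + `|b| by rewrite addr_ge0.
rewrite -(ger0_norm ab0) -sqrtr_sqr ler_wsqrtr// sqrrD !real_normK ?num_real//.
by rewrite addrAC lerDl mulrn_wge0// mulr_ge0.
Qed.

Lemma ReB z z' : complex.Re (z - z') = complex.Re z - complex.Re z'.
Proof. by case: z; case: z'. Qed.

Lemma ImB z z' : complex.Im (z - z') = complex.Im z - complex.Im z'.
Proof. by case: z; case: z'. Qed.

End ComplexNorm.

Section LpNorm.
Variables (R : realType) (p : R).
Hypothesis p_gt1 : 1 < p.

Let p_gt0 : 0 < p. Proof. exact: lt_trans p_gt1. Qed.

Section OnGroup.
Variable G : groupType.
Implicit Types (f : G -> R[i]).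

Let nf f x := normc (f x).

Let energy f := (\esum_(x in [set: G]) (normc (f x) `^ p)%:E)%E.

Let energy_le f M : (energy f <= M%:E)%E <-> lp_le p (nf f) M.
Proof.
split=> [fM s s_uniq|fM].
  rewrite -lee_fin; apply: le_trans fM; apply: esum_ge.
  exists [set` s]; first by split => //; exact: finite_seq.
  rewrite -fsbig_seq// -sumEFin le_eqVlt; apply/orP; left; apply/eqP.
  by apply: eq_bigr => x _; rewrite ger0_norm// normc_ge0.
apply: ge_ereal_sup => _ [X [/finite_seqP[s sX] _] <-].
have -> : X = [set` undup s] by rewrite sX; apply/seteqP; split => x /=;
  rewrite mem_undup.
rewrite -fsbig_seq ?undup_uniq// sumEFin lee_fin.
apply: le_trans (fM _ (undup_uniq s)); rewrite le_eqVlt; apply/orP; left.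
by apply/eqP/eq_bigr => x _; rewrite ger0_norm// normc_ge0.
Qed.

Let energy_ge0 f : (0 <= energy f)%E.
Proof. by apply: esum_ge0 => x _; rewrite lee_fin powR_ge0. Qed.

Lemma lpP f : lp p f <-> exists M, lp_le p (fun x => normc (f x)) M.
Proof.
rewrite /lp /= /lp_norm -/(energy f); split=> [fy|[M /energy_le fM]].
  have : (energy f < +oo)%E.
    by apply: lty_poweRy fy; rewrite invr_neq0// gt_eqF.
  have : (energy f <= energy f)%E by [].
  case: (energy f) (energy_ge0 f) (@energy_le f) => [M| |]// _ fE fM _.
  by exists M; apply/fE.
by apply: poweR_lty; apply: le_lt_trans fM _; rewrite ltry.
Qed.

Lemma lp_norm_ltP f e : 0 < e -> (lp_norm p f < e%:E)%E <->
  exists2 M, M < e `^ p & lp_le p (fun x => normc (f x)) M.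
Proof.
move=> e0; rewrite /lp_norm -/(energy f).
have eE : e = (e `^ p) `^ p^-1.
  by rewrite -powRrM mulfV ?gt_eqF// powRr1// ltW.
split=> [fe|[M Me /energy_le fM]].
  have : (energy f < +oo)%E.
    apply: (@lty_poweRy _ _ p^-1); first by rewrite invr_neq0// gt_eqF.
    by apply: lt_trans fe _; rewrite ltry.
  have : (energy f <= energy f)%E by [].
  case: (energy f) fe (energy_ge0 f) (@energy_le f) => [M| |]// fe.
  rewrite lee_fin => M0 fE fM _; exists M; last by apply/fE.
  move: fe; rewrite poweR_EFin lte_fin => Me.
  rewrite ltNge; apply/negP => eM.
  have : (e `^ p) `^ p^-1 <= M `^ p^-1.
    by apply: ge0_ler_powR; rewrite ?nnegrE ?powR_ge0 ?invr_ge0 ?(ltW p_gt0).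
  by rewrite -eE leNgt Me.
case: (energy f) (energy_ge0 f) fM => [N| |]//; rewrite !lee_fin => N0 NM.
rewrite poweR_EFin lte_fin eE.
apply: gt0_ltr_powR; rewrite ?invr_gt0 ?nnegrE ?powR_ge0//.
exact: le_lt_trans Me.
Qed.

Lemma lp_le_Re f M : lp_le p (fun x => normc (f x)) M ->
  lp_le p (fun x => complex.Re (f x)) M.
Proof.
apply: lp_le_dominated => // x; rewrite [leRHS]ger0_norm ?normc_ge0//.
exact: Re_le_normc.
Qed.

Lemma lp_le_Im f M : lp_le p (fun x => normc (f x)) M ->
  lp_le p (fun x => complex.Im (f x)) M.
Proof.
apply: lp_le_dominated => // x; rewrite [leRHS]ger0_norm ?normc_ge0//.
exact: Im_le_normc.
Qed.

Lemma lp_le_normc f M : lp_le p (fun x => complex.Re (f x)) M ->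
  lp_le p (fun x => complex.Im (f x)) M ->
  lp_le p (fun x => normc (f x)) (2 `^ p * M).
Proof.
move=> fR fI.
have abs u : lp_le p u M -> lp_le p (fun x : G => `|u x|) M.
  by apply: lp_le_dominated => // x; rewrite normr_id.
apply: lp_le_dominated (lp_leD p_gt1 (abs _ fR) (abs _ fI)) => // x /=.
rewrite [leLHS]ger0_norm ?normc_ge0// [leRHS]ger0_norm ?addr_ge0//.
exact: normc_le.
Qed.

Lemma cocycle_Re (b : G -> G -> R[i]) : cocycles p b ->
  real_cocycle (fun g x => complex.Re (b g x)) /\
  forall g, exists M, lp_le p (fun x => complex.Re (b g x)) M.
Proof.
move=> [blp bc]; split=> [g h|g].
  by apply/funext => x; rewrite bc /=; case: (b g x) => ? ?;
    rewrite /translate /left_regular; case: (b h _).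
by have /lpP[M /lp_le_Re bM] := blp g; exists M.
Qed.

Lemma cocycle_Im (b : G -> G -> R[i]) : cocycles p b ->
  real_cocycle (fun g x => complex.Im (b g x)) /\
  forall g, exists M, lp_le p (fun x => complex.Im (b g x)) M.
Proof.
move=> [blp bc]; split=> [g h|g].
  by apply/funext => x; rewrite bc /=; case: (b g x) => ? ?;
    rewrite /translate /left_regular; case: (b h _).
by have /lpP[M /lp_le_Im bM] := blp g; exists M.
Qed.

Lemma reduced_H1_trivial_real :
  (forall b : G -> G -> R, real_cocycle b ->
    (forall g, exists M, lp_le p (b g) M) -> approx_coboundary p setT b) ->
  reduced_H1_trivial p G.
Proof.
move=> real_trivial b bcoc F /finite_seqP[s ->] e e0.
have [bR bRM] := cocycle_Re bcoc; have [bI bIM] := cocycle_Im bcoc.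
(* Dividing by [2^p] compensates for recombining real and imaginary parts; the further 2 makes the
   final inequality strict. *)
have ep0 : 0 < e `^ p / 2 by rewrite divr_gt0// powR_gt0.
have e'0 : 0 < e `^ p / 2 / 2 `^ p by rewrite divr_gt0 ?powR_gt0.
have sT g : g \in s -> [set: G] g by [].
have [xiR [[MR xiRM] sR]] := real_trivial _ bR bRM s sT _ e'0.
have [xiI [[MI xiIM] sI]] := real_trivial _ bI bIM s sT _ e'0.
exists (fun g => left_regular g (fun x => Complex (xiR x) (xiI x))
  \- (fun x => Complex (xiR x) (xiI x)))%R.
  exists (fun x => Complex (xiR x) (xiI x)) => //.
  apply/lpP; exists (2 `^ p * (MR + MI)); apply: lp_le_normc.
    by apply: lp_leW xiRM; rewrite lerDl (lp_le_ge0 xiIM).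
  by apply: lp_leW xiIM; rewrite lerDr (lp_le_ge0 xiRM).
move=> g gs; apply/lp_norm_ltP => //; exists (e `^ p / 2).
  by rewrite ltr_pdivrMr// ltr_pMr ?powR_gt0// ltr1n.
have -> : e `^ p / 2 = 2 `^ p * (e `^ p / 2 / 2 `^ p).
  by rewrite [RHS]mulrC divfK// gt_eqF// powR_gt0.
apply: lp_le_normc.
  apply: lp_le_dominated (sR g gs) => // x.
  by rewrite /= /dif /translate !ReB /left_regular /=.
apply: lp_le_dominated (sI g gs) => // x.
by rewrite /= /dif /translate !ImB /left_regular /=.
Qed.

End OnGroup.

Variable G : groupType.

(** The function is carried to the coset [H y] by right multiplication by [y] and extended by 0.
    Distinct points of [H y] come from distinct elements of [H], so the energy does not grow. *)
Lemma lp_le_extension (H : groupClosed G) (y : G) (u : subgroup_type H -> R) M :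
  lp_le p u M -> lp_le p (fun x : G =>
    if (insub (x * y^-1)%g : option (subgroup_type H)) is Some z then u z else 0)
    M.
Proof.
move=> uM s s_uniq.
pose f x : option (subgroup_type H) := insub (x * y^-1)%g.
have fK : ocancel f (fun z => val z * y)%g.
  by move=> x; rewrite /f; case: insubP => //= z _ ->; rewrite mulgVK.
have := uM _ (pmap_uniq fK s_uniq); rewrite big_pmap; apply: le_trans.
apply: ler_sum => x _; rewrite /f; case: insub => [z|] //=.
by rewrite normr0 powR0// gt_eqF.
Qed.

(** On a right coset [H y], reading [b h] at the points [z * y] gives a cocycle of [H] in l^p of
    [H], to which the vanishing applies; extension by 0 leads back to [G]. *)
Lemma approx_coboundary_H1 (H : groupClosed G) (b : G -> G -> R) :
  real_cocycle b -> (forall g, exists M, lp_le p (b g) M) ->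
  reduced_H1_trivial p (subgroup_type H) -> approx_coboundary p [set` H] b.
Proof.
move=> bc bM H1; apply: (approx_coboundary_cosets p_gt1 bM) => y s sH e e0.
pose bH : subgroup_type H -> subgroup_type H -> R[i] :=
  fun h z => Complex (b (val h) (val z * y)%g) 0.
have bH_cocycle : cocycles p bH.
  split=> [h|g h].
    have [M hM] := bM (val h); apply/lpP; exists (2 `^ p * M).
    apply: lp_le_normc => /=.
      apply: (lp_le_comp (f := fun z : subgroup_type H => val z * y)%g) hM.
      by move=> z z' /mulIg /val_inj.
    apply: (lp_leW (lp_le_ge0 hM)) => t _; rewrite big1// => x _.
    by rewrite normr0 powR0// gt_eqF.
  apply/funext => z; rewrite /bH /left_regular /= bc /=.
  by rewrite /translate mulgA; apply/eqP; rewrite eq_complex /= addr0 !eqxx.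
(* The closure is stated with norms and [lp_le] with p-th powers, so the radius is the p-th root of
   [e]. *)
have e'0 : 0 < e `^ p^-1 by rewrite powR_gt0.
have F_fin : finite_set [set z : subgroup_type H | val z \in s].
  by apply: finite_preimage (finite_seq s); apply: in2W; exact: val_inj.
have [_ [xi /lpP[M xiM] <-] bH_le] := H1 bH bH_cocycle _ F_fin _ e'0.
pose ext (u : subgroup_type H -> R) (x : G) :=
  if (insub (x * y^-1)%g : option (subgroup_type H)) is Some z then u z else 0.
exists (ext (fun z => complex.Re (xi z))); split.
  by exists M; apply: lp_le_extension; exact: lp_le_Re.
move=> g gs; pose g' : subgroup_type H := exist _ g (sH g gs).
have /lp_norm_ltP[//|M' M'e /lp_le_Re /(lp_le_extension y) bM'] := bH_le g' gs.
have {}M'e : M' <= e.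
  by apply: ltW; move: M'e; rewrite -powRrM mulVf ?gt_eqF// powRr1// ltW.
apply: lp_leW M'e _; apply: lp_le_dominated bM' => // x.
rewrite /= /dif /translate /coset_restriction /= orbF /ext.
case: (@insubP _ _ (subgroup_type H) (x * y^-1)%g) => [z zH zE|/negbTE xH].
  have -> : (g^-1 * x * y^-1)%g = val (g'^-1 * z)%g by rewrite /= zE mulgA.
  have xE : (val z * y)%g = x by rewrite zE mulgVK.
  by rewrite zH valK !ReB /left_regular /bH /= xE.
rewrite xH; case: insubP => [z zH zE|]; last by rewrite !subrr.
(* With [x] outside [H y] and [g] in [H], the point [g^-1 * x] cannot lie in [H y]. *)
exfalso; move: zH; rewrite -mulgA gpredMl ?xH//.
by rewrite gpredV; exact: (sH _ gs).
Qed.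

End LpNorm.

Theorem corollary5p18 (R : realType) (p : R) (p_gt1 : 1 < p)
  (Gamma : groupType) (Gamma_countable : countable [set: Gamma])
  (disp : Order.disp_t) (I : tbOrderType disp) (Hs : I -> groupClosed Gamma)
  (H : groupClosed Gamma)
  (H_wq : wq_normal [set` H] (fun a : I => [set` Hs a]))
  (K : groupClosed Gamma) (K_sub_H : [set` K] `<=` [set` H])
  (d : R) (d_gtp : p < d) (K_growth : growth_at_least d [set` K])
  (H_succ : forall a b : I, ord_succ a b ->
     (finitely_generated [set` Hs a] -> q_normal [set` Hs a] [set` Hs b]) /\
     (~ finitely_generated [set` Hs a] -> normal_in [set` Hs a] [set` Hs b]))
  (H_H1_or_FC :
     reduced_H1_trivial p (subgroup_type H) \/
     exists2 a : I, ord_succ (\bot)%O a &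
       infinite_set (FC_centraliser [set` Hs a] [set` H])) :
  reduced_H1_trivial p Gamma.
Proof.
apply: (reduced_H1_trivial_real p_gt1) => b b_cocycle b_lp.
have bH : approx_coboundary p [set` H] b.
  case: H_H1_or_FC => [H1|[a _ FC_inf]].
    exact: approx_coboundary_H1.
  exact: approx_coboundary_FC FC_inf.
have [S [/finite_seqP[s0 ->] genS [c c0 growth]]] := K_growth.
(* The generators of [K] lie in [H], so approximation on [H] controls the differences that enter the
   Sobolev inequality. *)
have s0H g : g \in s0 -> [set` H] g.
  by move=> gs; apply: K_sub_H; rewrite -genS => M [_]; apply.
have [C C0 sup_le] := lp_sup_le p_gt1 c0 d_gtp growth.
have [xi xi0 xiE] := approx_coboundary_limit p_gt1 C0 s0H sup_le bH.
pose f x := b x^-1%g 1%g; have bE := real_cocycle_dif b_cocycle.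
have w_dif g : dif g (f \- xi) = b g \+ (\- dif g xi).
  by rewrite bE; apply/funext => x; rewrite /dif /translate /= /f; ring.
have w_vanishing g : vanishing (dif g (f \- xi)).
  rewrite w_dif; apply: vanishingD; last exact/vanishingN/vanishing_dif.
  by have [M bM] := b_lp g; exact: (lp_le_vanishing p_gt1 bM).
have w_H : [set` H] `<=` invariance_group (f \- xi).
  move=> h Hh; have := w_dif h; rewrite (xiE h Hh) => wE.
  apply/funext => x; apply/eqP; rewrite -subr_eq0.
  by have /(congr1 (@^~ x)) /= := wE; rewrite /dif /= subrr => ->.
have w_G := wq_normal_invariance w_vanishing H_wq w_H.
(* Invariance of [f - xi] under all of [Gamma] turns [b g = dif g f] into [b g = dif g xi], with
   [xi] vanishing at infinity. *)
apply: (approx_coboundary_vanishing p_gt1 xi0) => // g.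
apply/funext => x; apply/eqP; rewrite -subr_eq0.
have /(congr1 (@^~ x)) /= := w_dif g.
by rewrite /dif w_G /= subrr => <-.
Qed.
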